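(* Let $X$ be a real-valued random variable concentrated on an interval $I\subseteq\mathbb{R}$. Suppose that $f$ and $g$ are continuous real-valued functions on $I$ such that $f(X)$ and $g(X)$ have finite second order moments. Then there exist $t_1,t_2\in I$ such that \[ \operatorname{Cov}(f(X),g(X)) = \frac{1}{4}\left(f(t_1)-f(t_2)\right)\left(g(t_1)-g(t_2)\right). \]
   Context: Let $\mu_X$ denote the probability measure induced by $X$ on the Borel sigma-field of $\mathbb{R}$. The random variable $X$ is said to be concentrated on $B\subset\mathbb{R}$ if $\mu_X(B)=1$; in that case, for a measurable function $f$ on $B$, $\mathrm{E}\,f(X)=\int_B f(t)\,d\mu_X(t)$. The covariance of random variables $U$ and $V$ is $\operatorname{Cov}(U,V)=\mathrm{E}\,(U-\mathrm{E}\,U)(V-\mathrm{E}\,V)=\mathrm{E}(UV)-\mathrm{E}\,U\,\mathrm{E}\,V$. The interval $I$ is arbitrary (not necessarily closed or bounded). *)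

(* Defs.v *)
From HB Require Import structures.
From mathcomp Require Import all_boot all_order all_algebra.
From mathcomp Require Import all_classical all_reals all_analysis. 
From mathcomp Require Import measurable_realfun.
Set Implicit Arguments.
Unset Strict Implicit.
Unset Printing Implicit Defensive.
Import Order.TTheory GRing.Theory Num.Theory.
Import numFieldNormedType.Exports.
Local Open Scope classical_set_scope.
Local Open Scope ring_scope.

(** The random variable [f(X)], for a function [f] given on [B] only and [X]
    concentrated on [B]. Such an [f] is represented by a total function whose
    values outside [B] are discarded (replaced by [0]); this only matters on
    the event that [X] is not in [B], which has probability 0. By
    [expectation_comp_on], the expectation of [f(X)] is then the integral of
    [f] over [B] with respect to the law of [X]. *)
Definition comp_on (T : Type) (R : realType) (B : set R) (f : R -> R)
  (X : T -> R) : T -> R := (f \_ B) \o X.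

Lemma expectation_comp_on (d : measure_display) (T : measurableType d)
    (R : realType) (P : probability T R) (X : {RV P >-> R}) (B : set R)
    (f : R -> R) :
  measurable B -> (distribution P X).-integrable B (EFin \o f) ->
  ('E_P[comp_on B f X] = \int[distribution P X]_(t in B) (f t)%:E)%E.
Proof.
move=> mB intf.
have tr (h : R -> \bar R) : (distribution P X).-integrable setT h ->
    (\int[distribution P X]_y h y = \int[P]_w (h \o X) w)%E.
  move=> inth; have mh := measurable_int _ inth.
  apply: integral_distribution => //; apply/integrableP; split.
    exact: measurableT_comp mh _.
  move/integrableP : inth => [_]; rewrite ge0_integral_distribution //.
  exact: measurableT_comp.
rewrite unlock [RHS]integral_mkcond tr.
  by apply: eq_integral => w _; rewrite /comp_on /= /patch; case: ifP.
exact/(integrable_mkcond _ mB).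
Qed.

(* Main.v *)
Require Import Defs.
From HB Require Import structures.
From mathcomp Require Import all_boot all_order all_algebra.
From mathcomp Require Import all_classical all_reals all_analysis.
From mathcomp Require Import measurable_realfun ring lra.
Import Order.TTheory GRing.Theory Num.Theory.
Import numFieldNormedType.Exports.
Local Open Scope classical_set_scope.
Local Open Scope ring_scope.

(** The increment product [h s t = (f s - f t) * (g s - g t)] vanishes when
    [s = t] and is continuous on the interval, so by the intermediate value
    theorem it suffices to find two points of [I] for which [4 * C] lies
    between 0 and [h s t], where [C] is the covariance. The case [C = 0] is
    trivial, and replacing [g] by [- g] one may take [C > 0] and look for
    [4 * C <= h s t]. This part is a statement about two square-integrable
    variables [U], [V] on any probability space, and uses no continuity
    ([covariance_le_quarter_increments]). It extends Popoviciu's inequality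
    [Var U <= (max U - min U) ^+ 2 / 4], whose proof bounds the second moment
    about the midrange; the substitute for the midrange is found as follows.

    Suppose that all increment products over some almost sure event are less
    than [4 * C], and let [m] be the mean of [U]. Then for some [c] the points
    [(U, V)] arising from this event all lie in the region
    [(x - m) * (y - c) <= C] between the branches of a hyperbola
    ([hyperbola_center]). Indeed this asks that [c] be at least
    [V t - C / (U t - m)] whenever [U t > m], and at most
    [V s + C / (m - U s)] whenever [U s < m]; with [x = U t - m] and
    [y = m - U s], the compatibility of two such bounds is
    [V t - V s <= C / x + C / y], and this holds because the hypothesis gives
    [(x + y) * (V t - V s) <= 4 * C] while [4 / (x + y) <= 1 / x + 1 / y].

    Since [U - m] has mean 0, [(U - m) * (V - c)] has mean [C] whatever [c] is;
    being at most [C], it equals [C] almost surely. So almost every point lies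
    on the hyperbola, and on both of its branches since [U] takes values on
    both sides of its mean. Two points on opposite branches have an increment
    product of at least [4 * C], a contradiction. Arguing by contradiction
    in this way, rather than bounding [C] by a supremum, shows that the
    bound is attained even when [I] is not compact. *)

Set Implicit Arguments.
Unset Strict Implicit.

(** The arithmetic-harmonic mean inequality [4 / (x + y) <= 1 / x + 1 / y],
    in the form in which it makes the bounds on the center compatible. *)
Lemma le_sum_inverses (R : realFieldType) (x y C d : R) :
  0 < x -> 0 < y -> 0 < C -> (x + y) * d <= 4 * C -> d <= C / x + C / y.
Proof.
move=> x0 y0 C0 hd.
have -> : C / x + C / y = C * (x + y) / (x * y) by field; lra.
rewrite ler_pdivlMr ?mulr_gt0//.
rewrite -(ler_pM2l (addr_gt0 x0 y0)).
have : (x + y) * d * (x * y) <= 4 * C * (x * y).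
  by rewrite ler_pM2r ?mulr_gt0.
have : 0 <= C * (x - y) ^+ 2 by rewrite mulr_ge0 ?sqr_ge0 ?ltW.
nra.
Qed.

(** The set of admissible [c] is an interval, the lower bounds coming from the
    points right of [m] and the upper bounds from those left of [m]. Points on
    both sides are required: with [u] constant and [v] unbounded above and
    below, the increment products all vanish, yet no [c] is admissible unless
    [u] equals [m]. *)
Lemma hyperbola_center (R : realType) (S : Type) (A : set S) (u v : S -> R)
    (m C : R) : 0 < C ->
    (exists2 s, A s & u s < m) -> (exists2 t, A t & m < u t) ->
    (forall s t, A s -> A t -> (u s - u t) * (v s - v t) <= 4 * C) ->
  exists c, forall t, A t -> (u t - m) * (v t - c) <= C.
Proof.
move=> C0 [s0 As0 us0] [t0 At0 ut0] diam.
pose L := [set v t - C / (u t - m) | t in [set t | A t /\ m < u t]].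
have L_le s t : A s -> u s < m -> A t -> m < u t ->
    v t - C / (u t - m) <= v s + C / (m - u s).
  move=> As us At ut.
  rewrite lerBlDr addrAC -addrA -lerBlDl.
  apply: le_sum_inverses; rewrite ?subr_gt0//.
  by have := diam _ _ At As; apply: le_trans; rewrite le_eqVlt; apply/orP; left;
    apply/eqP; ring.
have supL : has_sup L.
  split; first by exists (v t0 - C / (u t0 - m)), t0.
  by exists (v s0 + C / (m - u s0)) => _ [t [At ut] <-]; exact: L_le.
exists (sup L) => t At; have [ut|ut|->] := ltgtP (u t) m.
- have : sup L <= v t + C / (m - u t).
    apply: ge_sup; first exact: supL.1.
    by move=> _ [s [As us] <-]; exact: L_le.
  rewrite -lerBlDl ler_pdivlMr ?subr_gt0//.
  by apply: le_trans; rewrite le_eqVlt; apply/orP; left; apply/eqP; ring.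
- have : v t - C / (u t - m) <= sup L.
    by apply: ub_le_sup; [exact: supL.2|exists t].
  rewrite lerBlDl -lerBlDr ler_pdivlMr ?subr_gt0//.
  by rewrite mulrC.
- by rewrite subrr mul0r ltW.
Qed.

(** With [a = C / x] and [b = C / y], the product is
    [C * (x - y) ^+ 2 / (- x * y)], and [(x - y) ^+ 2 >= 4 * (- x * y)] is
    [(x + y) ^+ 2 >= 0]. *)
Lemma hyperbola_opposite_branches (R : realFieldType) (x y a b C : R) :
    0 < C -> x < 0 -> 0 < y -> x * a = C -> y * b = C ->
  4 * C <= (x - y) * (a - b).
Proof.
move=> C0 x0 y0 xa yb.
have -> : a = C / x by rewrite -xa; field; rewrite lt_eqF.
have -> : b = C / y by rewrite -yb; field; rewrite gt_eqF.
have -> : (x - y) * (C / x - C / y) = C * ((x - y) ^+ 2 / ((- x) * y)).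
  by field; rewrite gt_eqF// lt_eqF.
rewrite mulrC ler_pM2l// ler_pdivlMr ?mulr_gt0 ?oppr_gt0//.
have := sqr_ge0 (x + y); nra.
Qed.

Section mean_zero.
Context d (T : measurableType d) (R : realType) (P : probability T R).

Lemma ae_eq0_of_ge0_mean0 (Z : T -> R) : Z \in Lfun P 1 -> ('E_P[Z] = 0)%E ->
  (\forall w \ae P, 0 <= Z w) -> \forall w \ae P, Z w = 0.
Proof.
move=> /Lfun1_integrable iZ; rewrite unlock => EZ Z0.
have mZ := measurable_int _ iZ.
have : (\int[P]_w `|(Z w)%:E| = 0)%E.
  rewrite -[RHS]EZ; apply: ae_eq_integral => //.
    exact: measurableT_comp.
  apply: filterS Z0 => w Z0 _; by rewrite gee0_abs// lee_fin.
move/(ae_eq_integral_abs P measurableT mZ).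
by apply: filterS => w /(_ I) [].
Qed.

(** A variable of one sign and mean 0 vanishes almost surely. The predicate [Q]
    serves to pick the two points where some almost sure property holds. *)
Lemma mean0_both_signs (Z : T -> R) (Q : set T) :
    Z \in Lfun P 1 -> ('E_P[Z] = 0)%E -> ~ (\forall w \ae P, Z w = 0) ->
    (\forall w \ae P, Q w) ->
  (exists2 s, Q s & Z s < 0) /\ (exists2 t, Q t & 0 < Z t).
Proof.
move=> lZ EZ nZ aeQ; split; apply: contrapT => nex; apply: nZ.
  apply: ae_eq0_of_ge0_mean0 => //; apply: filterS aeQ => w Qw.
  by rewrite leNgt; apply/negP => Zw; apply: nex; exists w.
have : \forall w \ae P, (\- Z) w = 0.
  apply: ae_eq0_of_ge0_mean0.
  - by rewrite rpredN.
  - have -> : (\- Z)%R = (-1 \o* Z)%R by apply/funext => w /=; rewrite mulrN1.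
    by rewrite expectationZl// EZ mule0.
  - apply: filterS aeQ => w Qw.
    by rewrite oppr_ge0 leNgt; apply/negP => Zw; apply: nex; exists w.
by apply: filterS => w /eqP; rewrite oppr_eq0 => /eqP.
Qed.

End mean_zero.

Section covariance_increments.
Context d (T : measurableType d) (R : realType) (P : probability T R).

Lemma probability_finite : P setT \is a fin_num.
Proof. exact: fin_num_measure. Qed.

(** If every increment product over [A] were less than [4 * C], all points of [A]
    would lie between the branches of a hyperbola, and a mean value computation
    would put almost all of them on it. The conclusion exhibits a pair of points
    because a bound by the supremum of the increment products would not suffice
    for the intermediate value argument. *)
Lemma covariance_le_quarter_increments (U V : T -> R) (A : set T) (C : R) :
    U \in Lfun P 2%:E -> V \in Lfun P 2%:E -> (\forall w \ae P, A w) ->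
    covariance P U V = C%:E -> 0 < C ->
  exists s t, [/\ A s, A t & 4 * C <= (U s - U t) * (V s - V t)].
Proof.
move=> U2 V2 aeA; rewrite unlock.
set m := fine ('E_P[U])%E; set n := fine ('E_P[V])%E => covC C0.
have U1 := Lfun_subset12 probability_finite U2.
have sub_cst2 (Z : T -> R) r :
    Z \in Lfun P 2%:E -> (Z \- cst r)%R \in Lfun P 2%:E.
  by move=> Z2; rewrite rpredB ?lee1n//= => _; rewrite Lfun_cst.
pose W := (U \- cst m)%R.
have W2 : W \in Lfun P 2%:E by exact: sub_cst2.
have W1 : W \in Lfun P 1 by exact: Lfun_subset12 probability_finite _ W2.
have EW : ('E_P[W] = 0)%E.
  rewrite expectationB// ?expectation_cst ?Lfun_cst//.
  by rewrite /m fineK ?subee// expectation_fin_num.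
have WV1 : (W \* (V \- cst n))%R \in Lfun P 1.
  by apply: Lfun2_mul_Lfun1 => //; exact: sub_cst2.
have W_neq0 : ~ (\forall w \ae P, W w = 0).
  move=> W0; move: covC; rewrite unlock.
  rewrite (ae_eq_integral (cst 0%E))// ?integral0.
  - by move=> [] C_eq0; move: C0; rewrite -C_eq0 ltxx.
  - by apply: measurable_int; exact/Lfun1_integrable/WV1.
  - apply: filterS W0 => w W0 _ /=; congr EFin.
    by rewrite [LHS](_ : _ = W w * (V w - n))// W0 mul0r.
apply: contrapT => nex.
have diam s t : A s -> A t -> (U s - U t) * (V s - V t) < 4 * C.
  by move=> As At; rewrite ltNge; apply/negP => ?; apply: nex; exists s, t.
(* Without points on both sides of [m] there might be no center: this is
   where [C > 0], which forces [U] to be nonconstant, is used. *)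
have [c cP] : exists c, forall t, A t -> (U t - m) * (V t - c) <= C.
  have [[s As Ws] [t At Wt]] := mean0_both_signs W1 EW W_neq0 aeA.
  apply: hyperbola_center => //.
  - by exists s => //; rewrite -subr_lt0.
  - by exists t => //; rewrite -subr_gt0.
  - by move=> *; exact/ltW/diam.
(* [D] is [C - (U - m) * (V - c)], arranged so that its mean can be read off:
   the covariance integrand plus a multiple of the centered variable [W]. *)
pose D := (cst C \- (W \* (V \- cst n)) \- ((n - c) \o* W))%R.
have DE w : D w = C - (U w - m) * (V w - c) by rewrite /D /W /=; ring.
have cW1 : ((n - c) \o* W)%R \in Lfun P 1 by exact: Lfun_scale.
have D0 : \forall w \ae P, D w = 0.
  apply: ae_eq0_of_ge0_mean0.
  - by rewrite !rpredB// Lfun_cst.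
  - rewrite !expectationB ?rpredB ?Lfun_cst// expectationZl// EW mule0 sube0.
    by rewrite expectation_cst [X in (_ - X)%E]covC subee.
  - by apply: filterS aeA => w /cP; rewrite DE subr_ge0.
have [[s [As Ds] Ws] [t [At Dt] Wt]] :=
  mean0_both_signs W1 EW W_neq0 (filterI aeA D0).
have := diam _ _ As At; rewrite ltNge => /negP; apply.
rewrite -[U s - U t](_ : (U s - m) - (U t - m) = _); last by ring.
rewrite -[V s - V t](_ : (V s - c) - (V t - c) = _); last by ring.
apply: hyperbola_opposite_branches => //.
- by move/eqP: Ds; rewrite DE subr_eq0 => /eqP.
- by move/eqP: Dt; rewrite DE subr_eq0 => /eqP.
Qed.

(** The form in which the intermediate value theorem applies to either sign of
    the covariance; a negative one is made positive by replacing [V] by [- V]. *)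
Lemma covariance_between_increments (U V : T -> R) (A : set T) (C : R) :
    U \in Lfun P 2%:E -> V \in Lfun P 2%:E -> (\forall w \ae P, A w) ->
    covariance P U V = C%:E ->
  exists s t, [/\ A s, A t &
    let h := (U s - U t) * (V s - V t) in
    Num.min 0 h <= 4 * C <= Num.max 0 h].
Proof.
move=> U2 V2 aeA covC; have [C0|C0|C0] := ltgtP C 0.
- have covN : covariance P U (\- V) = (- C)%:E.
    rewrite covarianceNr ?covC//; last exact: Lfun2_mul_Lfun1.
      exact: Lfun_subset12 probability_finite _ U2.
    exact: Lfun_subset12 probability_finite _ V2.
  have [||s [t [As At h]]] := covariance_le_quarter_increments U2 _ aeA covN;
    rewrite ?rpredN ?oppr_gt0//.
  exists s, t; split => //=; rewrite ge_min le_max; apply/andP; split; apply/orP.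
    by right; move: h => /=; lra.
  by left; lra.
- have [s [t [As At h]]] := covariance_le_quarter_increments U2 V2 aeA covC C0.
  exists s, t; split => //=; rewrite ge_min le_max h orbT andbT.
  by rewrite mulr_ge0// ltW.
- have [w Aw] : exists w, A w.
    have PT : (0 < P setT)%E by rewrite probability_setT.
    by have := @filter_ex _ _ (ae_properfilter_algebraOfSetsType PT) _ aeA.
  exists w, w; split => //=.
  by rewrite C0 mulr0 subrr mul0r ge_min le_max lexx.
Qed.

End covariance_increments.

(** Keeping [s] fixed and moving only the other point makes this the
    one-dimensional intermediate value theorem, on a path from the value 0. *)
Lemma ivt_increments (R : realType) (I : interval R) (f g : R -> R) (s t v : R) :
    {within [set` I], continuous f} -> {within [set` I], continuous g} ->
    s \in I -> t \in I ->
    (let h := (f s - f t) * (g s - g t) in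
     Num.min 0 h <= v <= Num.max 0 h) ->
  exists2 r, r \in I & (f s - f r) * (g s - g r) = v.
Proof.
move=> fc gc sI tI /= hv.
pose F r := (f s - f r) * (g s - g r).
have Fc : {within [set` I], continuous F}.
  move=> x; apply: cvgM; (apply: cvgB; first exact: cvg_cst).
    exact: fc.
  exact: gc.
have Fs : F s = 0 by rewrite /F subrr mul0r.
have sub a b : a \in I -> b \in I -> [set` `[a, b]] `<=` [set` I].
  move=> aI bI x /=; rewrite in_itv/= => axb.
  exact: (interval_is_interval aI bI axb).
have [st|/ltW ts] := leP s t.
  have [||r rst Fr] := @IVT _ F s t v st _ _.
  - by apply: continuous_subspaceW Fc; exact: sub.
  - by rewrite Fs.
  - by exists r => //; exact: (sub _ _ sI tI).
have [||r rst Fr] := @IVT _ F t s v ts _ _.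
- by apply: continuous_subspaceW Fc; exact: sub.
- by rewrite Fs minC maxC.
- by exists r => //; exact: (sub _ _ tI sI).
Qed.

Lemma comp_on_Lfun2 d (T : measurableType d) (R : realType)
    (P : probability T R) (X : {RV P >-> R}) (B : set R) (f : R -> R) :
    measurable B -> {within B, continuous f} ->
    ('E_P[comp_on B f X ^+ 2] < +oo)%E ->
  comp_on B f X \in Lfun P 2%:E.
Proof.
move=> mB fc; rewrite unlock => f2.
have mf : measurable_fun setT (comp_on B f X).
  apply: measurableT_comp => //.
  apply/(measurable_restrictT _ mB).
  exact: subspace_continuous_measurable_fun.
rewrite inE; apply/andP; split; rewrite inE//=.
rewrite /finite_norm unlock /Lnorm poweR_lty//.
apply: le_lt_trans f2; rewrite le_eqVlt; apply/orP; left; apply/eqP.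
apply: eq_integral => w _ /=; congr EFin.
by rewrite powR_mulrn// real_normK ?num_real.
Qed.

Unset Implicit Arguments.
Set Strict Implicit.

Theorem theorem5 (d : measure_display) (T : measurableType d) (R : realType)
    (P : probability T R) (X : {RV P >-> R}) (I : interval R) (f g : R -> R)
    (X_on_I : distribution P X [set` I] = 1%E)
    (f_cont : {within [set` I], continuous f})
    (g_cont : {within [set` I], continuous g})
    (f_mom2 : ('E_P[comp_on [set` I] f X ^+ 2] < +oo)%E)
    (g_mom2 : ('E_P[comp_on [set` I] g X ^+ 2] < +oo)%E) :
  exists t1 t2 : R, [/\ t1 \in I, t2 \in I &
    covariance P (comp_on [set` I] f X) (comp_on [set` I] g X) =
      (4^-1 * (f t1 - f t2) * (g t1 - g t2))%:E].
Proof.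
set B := [set` I] in X_on_I f_cont g_cont f_mom2 g_mom2 *.
have mB : measurable B by exact: measurable_itv.
have f2 := comp_on_Lfun2 mB f_cont f_mom2.
have g2 := comp_on_Lfun2 mB g_cont g_mom2.
have fT := probability_finite P.
have aeI : \forall w \ae P, X w \in I.
  have mXB : measurable (X @^-1` B).
    by rewrite -[X in measurable X]setTI; exact: measurable_funP.
  exists (~` (X @^-1` B)); split.
  - exact: measurableC.
  - rewrite probability_setC//.
    by rewrite [X in (_ - X)%E]X_on_I subee.
  - by move=> w.
have /fineK/esym covC :
    covariance P (comp_on B f X) (comp_on B g X) \is a fin_num.
  apply: covariance_fin_num; [exact: Lfun_subset12 fT _ f2
    |exact: Lfun_subset12 fT _ g2|exact: Lfun2_mul_Lfun1].
have [w1 [w2 [w1I w2I]]] := covariance_between_increments f2 g2 aeI covC.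
have comp_onE h w : X w \in I -> comp_on B h X w = h (X w).
  by move=> wI; rewrite /comp_on /= patchE ifT// inE.
rewrite !comp_onE// => /(ivt_increments f_cont g_cont w1I w2I)[r rI hr].
exists (X w1), r; split => //.
by rewrite [LHS]covC -mulrA hr mulKf.
Qed.
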